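(* Let $p$ be a nonzero real number, and let $x_0,x_1,a_0,a_1$ be nonzero complex numbers such that $x_1/x_0$ and $a_1/a_0$ are positive real numbers. Then $C\big(H_p((a_0x_0,a_0),(a_1x_1,a_1))\big)$ is a weak averaging operator on $x_0=C(a_0x_0,a_0)$ and $x_1=C(a_1x_1,a_1)$.
   Context: For $p\in\mathbb{R}\setminus\{0\}$ the Hölder-Minkowski operation on pairs of complex numbers is $H_p((y_0,b_0),(y_1,b_1))=\big((y_0^p+y_1^p)^{1/p},\,(b_0^p+b_1^p)^{1/p}\big)$. The projection operator is $C((ax,a))=(x,1)$ for $a\neq 0$, identified with the number $x$. Thus $C(H_p((a_0x_0,a_0),(a_1x_1,a_1)))=\left(\frac{a_0^px_0^p+a_1^px_1^p}{a_0^p+a_1^p}\right)^{1/p}$. Convention on powers: complex numbers are kept in a general polar form $re^{i\theta}$, with the real argument $\theta$ not reduced modulo $2\pi$, and powers are taken as $(re^{i\theta})^p=r^pe^{ip\theta}$. Hence $(z^p)^{1/p}=z$, $(z^{1/p})^p=z$ and $(zw)^p=z^pw^p$ always hold. Positive real factors have argument $0$, and their powers are the usual positive real powers. Weak averaging operator: a binary operation $H:S^2\to S$ is a weak averaging operator if, labelling the two inputs so that $x_0$ is the smaller one, for all $x_0,x_1$ with $x_1=t_1x_0$, where $t_1$ is a real number greater than $1$, one has $1\le \frac{H(x_0,x_1)}{x_0}\le t_1$. Here $S$ is the set of complex numbers. *)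

(* Defs.v *)
From HB Require Import structures.
From mathcomp Require Import all_boot all_order all_algebra.
From mathcomp Require Import all_classical all_reals all_analysis.
From mathcomp Require Import complex ring.

Set Implicit Arguments.
Unset Strict Implicit.
Unset Printing Implicit Defensive.

Import Order.TTheory GRing.Theory Num.Theory.
Local Open Scope ring_scope.
Local Open Scope complex_scope.

(* [Polar r theta] is the complex number r e^(i theta) kept in polar form: theta
   is an arbitrary real, not reduced modulo 2 pi. Zero is any form of modulus 0. *)
Record polar (R : realType) := Polar { modulus : {nonneg R}; argument : R }.

Definition is_zero (R : realType) (u : polar R) : bool :=
  (modulus u)%:num == 0.

Definition toC (R : realType) (u : polar R) : R[i] :=
  ((modulus u)%:num * cos (argument u)) +i* ((modulus u)%:num * sin (argument u)).

(* Positive reals get argument 0 and negative reals argument pi. *)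
Definition polar_real (R : realType) (r : R) : polar R :=
  Polar `|r|%:nng (if r < 0 then pi else 0).

Definition is_positive_real (R : realType) (u : polar R) : Prop :=
  exists2 r : R, 0 < r & u = polar_real r.

Definition polar_mul (R : realType) (u v : polar R) : polar R :=
  Polar ((modulus u)%:num * (modulus v)%:num)%:nng (argument u + argument v).

(* Junk value, of modulus 0, when v is zero. *)
Definition polar_div (R : realType) (u v : polar R) : polar R :=
  Polar ((modulus u)%:num / (modulus v)%:num)%:nng (argument u - argument v).

Definition polar_pow (R : realType) (u : polar R) (p : R) : polar R :=
  Polar ((modulus u)%:num `^ p)%:nng (p * argument u).

(* Argument in (-pi, pi] (for z != 0). *)
Definition principal_arg (R : realType) (z : R[i]) : R :=
  let c := acos (complex.Re z / Normc.normc z) in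
  if complex.Im z < 0 then - c else c.

Lemma normc_nonneg (R : realType) (z : R[i]) : 0 <= Normc.normc z.
Proof. by case: z => a b; exact: sqrtr_ge0. Qed.

(* The polar form of z whose argument lies in (m - pi, m + pi]. *)
Definition polar_near (R : realType) (m : R) (z : R[i]) : polar R :=
  Polar (NngNum (normc_nonneg z))
    (m + principal_arg (z * toC (Polar 1%:nng (- m)))).

(* The value of the sum is the sum of the values (toC_polar_add below), but a branch
   of its argument must be chosen: we take the one nearest to the mean of the
   arguments of the two terms. In particular, terms with the same argument theta
   have a sum with argument theta. *)
Definition polar_add (R : realType) (u v : polar R) : polar R :=
  if is_zero u then v else if is_zero v then u else
  polar_near ((argument u + argument v) / 2) (toC u + toC v).

Lemma principal_argE (R : realType) (z : R[i]) :
  z = (Normc.normc z * cos (principal_arg z)) +i*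
      (Normc.normc z * sin (principal_arg z)).
Proof.
case: z => x y; rewrite /principal_arg /=; set n := Num.sqrt _.
have n2 : n ^+ 2 = x ^+ 2 + y ^+ 2 by rewrite sqr_sqrtr ?addr_ge0 ?sqr_ge0.
have [n0|n0] := eqVneq n 0.
  move: n2; rewrite n0 !mul0r expr0n /= => /esym/eqP.
  by rewrite paddr_eq0 ?sqr_ge0// !sqrf_eq0 => /andP[/eqP-> /eqP->].
have ngt0 : 0 < n by rewrite lt0r n0 sqrtr_ge0.
have xn : `|x / n| <= 1.
  rewrite normrM normfV (gtr0_norm ngt0) ler_pdivrMr// mul1r.
  rewrite -[leLHS]sqrtr_sqr ler_wsqrtr// lerDl sqr_ge0//.
have S : n * sin (acos (x / n)) = `|y|.
  rewrite sin_acos -?ler_norml// -{1}(gtr0_norm ngt0) -sqrtr_sqr -sqrtrM ?sqr_ge0//.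
  rewrite mulrBr mulr1 -exprMn mulrC divfK// n2 -sqrtr_sqr; congr Num.sqrt; ring.
have C : n * cos (acos (x / n)) = x.
  by rewrite acosK ?in_itv/= -?ler_norml// mulrC divfK.
case: ltP => y0; rewrite ?cosN ?sinN ?mulrN S C.
  by rewrite ltr0_norm ?opprK.
by rewrite ger0_norm.
Qed.

Lemma normc_toC (R : realType) (u : polar R) :
  Normc.normc (toC u) = (modulus u)%:num.
Proof.
by rewrite /= !exprMn -mulrDr cos2Dsin2 mulr1 sqrtr_sqr ger0_norm.
Qed.

Lemma toC_polar_near (R : realType) (m : R) (z : R[i]) :
  toC (polar_near m z) = z.
Proof.
rewrite /toC /polar_near [modulus _]/= [argument _]/=.
set w := z * _; have := principal_argE w.
have -> : Normc.normc w = Normc.normc z.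
  by rewrite Normc.normcM normc_toC mulr1.
move: (principal_arg w) => th; rewrite {}/w.
have -> : (NngNum (normc_nonneg z))%:num = Normc.normc z by [].
rewrite cosD sinD.
case: z => x y; move: (Normc.normc _) => r [].
rewrite /= !mul1r cosN sinN => e1 e2.
have := cos2Dsin2 m; move: (cos m) (sin m) e1 e2 => c s e1 e2 cs.
have {}e1 : r * cos th = x * c + y * s by rewrite -e1; ring.
have {}e2 : r * sin th = y * c - x * s by rewrite -e2; ring.
congr (_ +i* _).
  transitivity (c * (r * cos th) - s * (r * sin th)); first by ring.
  by rewrite e1 e2 -[RHS]mulr1 -cs; ring.
transitivity (s * (r * cos th) + c * (r * sin th)); first by ring.
by rewrite e1 e2 -[RHS]mulr1 -cs; ring.
Qed.

Lemma toC_zero (R : realType) (u : polar R) : is_zero u -> toC u = 0.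
Proof. by rewrite /toC => /eqP ->; rewrite !mul0r. Qed.

Lemma toC_polar_add (R : realType) (u v : polar R) :
  toC (polar_add u v) = toC u + toC v.
Proof.
rewrite /polar_add; case: ifPn => [/toC_zero->|_]; first by rewrite add0r.
by case: ifPn => [/toC_zero->|_]; rewrite ?addr0 ?toC_polar_near.
Qed.

Definition holder_minkowski (R : realType) (p : R)
    (u v : polar R * polar R) : polar R * polar R :=
  (polar_pow (polar_add (polar_pow u.1 p) (polar_pow v.1 p)) p^-1,
   polar_pow (polar_add (polar_pow u.2 p) (polar_pow v.2 p)) p^-1).

(* (x, 1) is identified with x. *)
Definition projection (R : realType) (u : polar R * polar R) : polar R :=
  polar_div u.1 u.2.

(* The condition 1 <= h / x <= t of weak averaging, where h / x is required to
   be real. *)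
Definition ratio_between (R : realType) (h x : polar R) (t : R) : Prop :=
  exists2 s : R, polar_div h x = polar_real s & 1 <= s <= t.

(* H is weak averaging on the inputs x0, x1; a weak averaging operator is one
   for which this holds on all (nonzero) inputs. The two clauses are the two
   possible labellings: either input may be the smaller one. *)
Definition weak_averaging_on (R : realType) (H : polar R -> polar R -> polar R)
    (x0 x1 : polar R) : Prop :=
  (forall t : R, 1 < t -> x1 = polar_mul (polar_real t) x0 ->
     ratio_between (H x0 x1) x0 t) /\
  (forall t : R, 1 < t -> x0 = polar_mul (polar_real t) x1 ->
     ratio_between (H x0 x1) x1 t).

(* Main.v *)
Require Import Defs.
From mathcomp Require Import all_boot all_order all_algebra.
From mathcomp Require Import all_classical all_reals all_analysis.
From mathcomp Require Import complex ring.
Import Order.TTheory GRing.Theory Num.Theory.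
Local Open Scope ring_scope.

(** The positivity of [x1 / x0] and [a1 / a0] forces the formal arguments of
    [x0], [x1] to be equal, and likewise those of [a0], [a1].  Raising to the
    power [p], adding terms of equal argument and raising to the power [1 / p]
    then brings the common argument back unchanged, so that the projection of
    the Hölder-Minkowski sum has the argument of [x0] and, as modulus, the
    quotient [N (A0 X0) (A1 X1) / N A0 A1] of two values of
    [N u v = (u ^ p + v ^ p) ^ (1 / p)], where [Ai], [Xi] are the moduli of
    [ai], [xi].

    This quotient lies between [X0] and [X1] because [N] is nondecreasing on
    positive reals ([holder_sum_le]) and homogeneous ([holder_sumMr]): if
    [m <= Xi <= M] for both [i] then
    [m * N A0 A1 <= N (A0 X0) (A1 X1) <= M * N A0 A1] ([power_mean_between]).
    For [p < 0] monotonicity still holds, since both powers [p] and [1 / p]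
    then reverse the order. *)

Lemma polar_ext (R : realType) (u v : polar R) :
  (modulus u)%:num = (modulus v)%:num -> argument u = argument v -> u = v.
Proof.
by case: u v => [r a] [s b] /= rs ->; congr Polar; exact: val_inj.
Qed.

Lemma modulus_gt0 (R : realType) (u : polar R) :
  ~~ is_zero u -> 0 < (modulus u)%:num.
Proof. by rewrite /is_zero lt0r ge0 andbT. Qed.

(** The branch of the argument chosen in [polar_near] is relative to the mean of
    the arguments; after rotation by the common argument the sum is a positive
    real, whose principal argument is [acos 1 = 0]. *)
Lemma polar_add_eq_arg (R : realType) (u v : polar R) :
  argument u = argument v ->
  polar_add u v =
    Polar ((modulus u)%:num + (modulus v)%:num)%:nng (argument u).
Proof.
move=> uv; rewrite /polar_add.
case: ifPn => [/eqP u0|u_neq0].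
  by apply: polar_ext => //=; rewrite u0 add0r.
case: ifPn => [/eqP v0|v_neq0].
  by apply: polar_ext => //=; rewrite v0 addr0.
have r_gt0 := addr_gt0 (modulus_gt0 _ _ u_neq0) (modulus_gt0 _ _ v_neq0).
have mean : (argument u + argument v) / 2 = argument u.
  by rewrite -uv; field.
set w := RHS.
have sumE : toC u + toC v = toC w.
  by rewrite /toC -uv /w /=; congr Complex; rewrite mulrDl.
rewrite mean sumE; apply: polar_ext; first exact: normc_toC.
have rotE : toC w * toC (Polar 1%:nng (- argument u))
    = Complex ((modulus u)%:num + (modulus v)%:num) 0.
  rewrite /toC /= !mul1r cosN sinN /w /=; congr Complex; last by ring.
  by rewrite -[RHS]mulr1 -(cos2Dsin2 (argument u)); ring.
rewrite [LHS]/= rotE /principal_arg /= ltxx expr0n addr0 sqrtr_sqr.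
by rewrite gtr0_norm// divff ?gt_eqF// acos1 addr0.
Qed.

Lemma ratio_arg_eq (R : realType) (u v : polar R) :
  is_positive_real (polar_div u v) -> argument u = argument v.
Proof.
move=> [r r_gt0 /(congr1 (@argument R))] /=.
by rewrite ltNge (ltW r_gt0)/= => /subr0_eq.
Qed.

Lemma projection_mulK (R : realType) (a x : polar R) :
  ~~ is_zero a -> x = projection (polar_mul a x, a).
Proof.
move=> /modulus_gt0 a_gt0; apply: polar_ext => /=.
  by rewrite mulrAC divff ?mul1r// gt_eqF.
by rewrite addrAC subrr add0r.
Qed.

Definition holder_sum (R : realType) (p u v : R) : R :=
  (u `^ p + v `^ p) `^ p^-1.

Lemma holder_sum_gt0 (R : realType) (p u v : R) :
  0 < u -> 0 < v -> 0 < holder_sum R p u v.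
Proof. by move=> u0 v0; rewrite powR_gt0// addr_gt0 ?powR_gt0. Qed.

Lemma lt0_ler_powR (R : realType) (p u v : R) :
  p < 0 -> 0 < u -> u <= v -> v `^ p <= u `^ p.
Proof.
move=> p0 u0 uv; have v0 := lt_le_trans u0 uv.
rewrite -[p]opprK !(powRN _ (- p)) lef_pV2 ?posrE ?powR_gt0//.
by apply: ge0_ler_powR; rewrite ?nnegrE ?oppr_ge0 // ltW.
Qed.

(** The two powers [p] and [1 / p] have exponents of the same sign, so they
    both preserve or both reverse the order. *)
Lemma holder_sum_le (R : realType) (p u v u' v' : R) :
  p != 0 -> 0 < u -> 0 < v -> u <= u' -> v <= v' ->
  holder_sum R p u v <= holder_sum R p u' v'.
Proof.
move=> p_neq0 u0 v0 uu' vv'; rewrite /holder_sum.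
have [u'0 v'0] := (lt_le_trans u0 uu', lt_le_trans v0 vv').
have /orP[p0|p0] : (p < 0) || (0 < p) by rewrite -neq_lt.
  apply: lt0_ler_powR; rewrite ?invr_lt0// ?addr_gt0 ?powR_gt0//.
  by rewrite lerD// lt0_ler_powR.
apply: ge0_ler_powR; rewrite ?nnegrE ?invr_ge0 ?addr_ge0 ?powR_ge0 ?(ltW p0)//.
by rewrite lerD// ge0_ler_powR ?nnegrE// ltW.
Qed.

Lemma holder_sumMr (R : realType) (p u v m : R) :
  p != 0 -> 0 <= u -> 0 <= v -> 0 <= m ->
  holder_sum R p (u * m) (v * m) = holder_sum R p u v * m.
Proof.
move=> p_neq0 u0 v0 m0; rewrite /holder_sum !powRM// -mulrDl.
by rewrite powRM ?addr_ge0 ?powR_ge0// -powRrM divff// powRr1.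
Qed.

Lemma power_mean_between (R : realType) (p a0 a1 y0 y1 m M : R) :
  p != 0 -> 0 < a0 -> 0 < a1 -> 0 < m ->
  m <= y0 <= M -> m <= y1 <= M ->
  m <= holder_sum R p (a0 * y0) (a1 * y1) / holder_sum R p a0 a1 <= M.
Proof.
move=> p_neq0 a0_gt0 a1_gt0 m_gt0 /andP[my0 y0M] /andP[my1 y1M].
have y0_gt0 := lt_le_trans m_gt0 my0; have y1_gt0 := lt_le_trans m_gt0 my1.
have M_gt0 := lt_le_trans y0_gt0 y0M.
have N_gt0 := holder_sum_gt0 R p _ _ a0_gt0 a1_gt0.
have NE c : 0 < c ->
    c * holder_sum R p a0 a1 = holder_sum R p (a0 * c) (a1 * c).
  by move=> c_gt0; rewrite mulrC holder_sumMr// ltW.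
rewrite ler_pdivlMr// ler_pdivrMr// (NE m)// (NE M)//.
by apply/andP; split; apply: holder_sum_le; rewrite ?mulr_gt0 ?ler_pM2l.
Qed.

(** With equal arguments the choice of branches disappears from
    [holder_minkowski]: multiplying an argument by [p] and by [1 / p] is the
    identity, and the argument of the common factor [a0] cancels. *)
Lemma projection_holder_minkowski (R : realType) (p : R)
    (x0 x1 a0 a1 : polar R) :
  p != 0 -> argument x1 = argument x0 -> argument a1 = argument a0 ->
  let h := projection
    (holder_minkowski p (polar_mul a0 x0, a0) (polar_mul a1 x1, a1)) in
  (modulus h)%:num =
    holder_sum R p ((modulus a0)%:num * (modulus x0)%:num)
                   ((modulus a1)%:num * (modulus x1)%:num)
    / holder_sum R p (modulus a0)%:num (modulus a1)%:num
  /\ argument h = argument x0.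
Proof.
move=> p_neq0 xE aE /=.
rewrite !polar_add_eq_arg /= ?xE ?aE//.
by split=> //; rewrite !mulKf// addrAC subrr add0r.
Qed.

Lemma ratio_betweenP (R : realType) (h x : polar R) (t : R) :
  0 < (modulus x)%:num -> argument h = argument x ->
  (modulus x)%:num <= (modulus h)%:num <= t * (modulus x)%:num ->
  ratio_between h x t.
Proof.
move=> x_gt0 hx /andP[xh ht].
exists ((modulus h)%:num / (modulus x)%:num); last first.
  by rewrite ler_pdivlMr// mul1r xh ler_pdivrMr.
have s_ge0 : 0 <= (modulus h)%:num / (modulus x)%:num.
  by rewrite divr_ge0 ?(ltW x_gt0).
apply: polar_ext => /=; first by rewrite ger0_norm.
by rewrite ltNge s_ge0/= hx subrr.
Qed.

Theorem theorem9p2 (R : realType) (p : R) (x0 x1 a0 a1 : polar R)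
    (p_neq0 : p != 0)
    (x0_neq0 : ~~ is_zero x0) (x1_neq0 : ~~ is_zero x1)
    (a0_neq0 : ~~ is_zero a0) (a1_neq0 : ~~ is_zero a1)
    (x_ratio : is_positive_real (polar_div x1 x0))
    (a_ratio : is_positive_real (polar_div a1 a0)) :
  [/\ x0 = projection (polar_mul a0 x0, a0),
      x1 = projection (polar_mul a1 x1, a1) &
      weak_averaging_on
        (fun u v => projection
           (holder_minkowski p (polar_mul a0 u, a0) (polar_mul a1 v, a1)))
        x0 x1].
Proof.
have xE := ratio_arg_eq _ _ _ x_ratio; have aE := ratio_arg_eq _ _ _ a_ratio.
have [hE hA] := projection_holder_minkowski _ _ _ _ _ _ p_neq0 xE aE.
have [x0_gt0 x1_gt0] := (modulus_gt0 _ _ x0_neq0, modulus_gt0 _ _ x1_neq0).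
have [a0_gt0 a1_gt0] := (modulus_gt0 _ _ a0_neq0, modulus_gt0 _ _ a1_neq0).
split; [exact: projection_mulK|exact: projection_mulK|split=> t t_gt1 tE].
- have mE : (modulus x1)%:num = t * (modulus x0)%:num.
    by rewrite tE /= gtr0_norm// (lt_trans ltr01).
  apply: ratio_betweenP => //; rewrite hE.
  by apply: power_mean_between; rewrite // ?mE ?lexx ?andbT ler_peMl// ltW.
- have mE : (modulus x0)%:num = t * (modulus x1)%:num.
    by rewrite tE /= gtr0_norm// (lt_trans ltr01).
  apply: ratio_betweenP; rewrite ?hA// hE.
  by apply: power_mean_between; rewrite // ?mE ?lexx ?andbT ler_peMl// ltW.
Qed.
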